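(* Let the hyperbolic model, the random parameterized inputs and the sampling model be as described in the context (deterministic dynamics, Lipschitz input parameterization, $N$ independent input samples), and assume that the PDE $\partial_tu+\nabla\cdot(\mathbf q(u;\boldsymbol\theta_q))=r(u;\boldsymbol\theta_r)$ is linear. Fix a confidence level $1-\beta$, $\beta\in(0,1)$, and let $w(\mathbf x,t)$ be the solution of $$\frac{\partial w}{\partial t}+\dot{\mathbf q}\cdot\nabla w-\dot r\,w=0,\qquad \mathbf x\in\Omega,\ t>0,$$ with initial condition $w(\mathbf x,0)=w_0(\mathbf x):=L_0(\mathbf x)\,\epsilon_N(\beta,\rho_{\mathbf a})$, $\mathbf x\in\Omega$, and boundary condition $w(\mathbf x,t)=w_b(\mathbf x,t):=L_b(\mathbf x,t)\,\epsilon_N(\beta,\rho_{\mathbf a})$, $(\mathbf x,t)\in\Gamma\times\mathbb R_{\ge0}$. Let $\widehat F^N_{u(\mathbf x,t)}$ be the solution of the CDF equation $$\frac{\partial F}{\partial t}+\dot{\mathbf q}(U;\boldsymbol\theta_q)\cdot\nabla F+r(U;\boldsymbol\theta_r)\frac{\partial F}{\partial U}=0,\qquad (U,\mathbf x)\in\mathbb R\times\Omega,\ t>0,$$ with initial and boundary data the empirical CDFs $\widehat F^N_{u_0(\mathbf x)}$ and $\widehat F^N_{u_b(\mathbf x,t)}$, and define $$\mathcal P_{\mathbf x,t}:=\big\{F\in\mathcal{CD}(\mathbb R)\,\big|\,W_1(\widehat F^N_{u(\mathbf x,t)},F)\le w(\mathbf x,t)\big\},\qquad \mathbf x\in\Omega,\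 t\in\mathbb R_{\ge0}.$$ Then $$\mathbb P\big(F^{\mathrm{true}}_{u(\mathbf x,t)}\in\mathcal P_{\mathbf x,t}\ \ \forall(\mathbf x,t)\in\Omega\times\mathbb R_{\ge0}\big)\ge1-\beta .$$
   Context: **Model.** $\Omega\subset\mathbb R^d$ is a semi-infinite spatial domain with upstream boundary $\Gamma$, and $u(\mathbf x,t)$ solves $\partial_t u+\nabla\cdot(\mathbf q(u;\boldsymbol\theta_q))=r(u;\boldsymbol\theta_r)$ for $\mathbf x\in\Omega$, $t>0$, with $u(\mathbf x,0)=u_0(\mathbf x)$ on $\Omega$ and $u(\mathbf x,t)=u_b(\mathbf x,t)$ for $\mathbf x\in\Gamma$, $t>0$. The parameters $\boldsymbol\theta_q,\boldsymbol\theta_r$ may depend on $(\mathbf x,t)$. Write $\dot{\mathbf q}=\partial\mathbf q/\partial U$, $\dot r=\partial r/\partial U$; ''linear'' means $\mathbf q$ and $r$ are linear in $u$, so $\dot{\mathbf q}$ and $\dot r$ do not depend on $U$. *Deterministic dynamics:* $\mathbf q,r,\boldsymbol\theta_q,\boldsymbol\theta_r$ are deterministic and $\nabla\cdot\mathbf q(U;\boldsymbol\theta_q)=0$ for each fixed value $U$. *Existence and uniqueness:* for each initial and boundary condition from their probability space the solution $u$ is smooth and defined for all $\mathbf x\in\Omega$, $t\ge0$. *Input parameterization:* $u_0(\mathbf x)=u_0(\mathbf x;\mathbf a)$, $u_b(\mathbf x,t)=u_b(\mathbf x,t;\mathbf a)$, where $\mathbf a$ is a random vector with (unknown) distribution $P^{\mathrm{true}}_{\mathbf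 a}$ supported on a compact subset of $\mathbb R^n$, and $|u_0(\mathbf x;\mathbf a)-u_0(\mathbf x;\mathbf a')|\le L_0(\mathbf x)\|\mathbf a-\mathbf a'\|$ for all $\mathbf x\in\Omega$, $|u_b(\mathbf x,t;\mathbf a)-u_b(\mathbf x,t;\mathbf a')|\le L_b(\mathbf x,t)\|\mathbf a-\mathbf a'\|$ for all $\mathbf x\in\Gamma$, $t\ge0$, for all $\mathbf a,\mathbf a'\in\mathbb R^n$ (Euclidean norm), with $L_0:\Omega\to\mathbb R_{\ge0}$, $L_b:\Gamma\times\mathbb R_{\ge0}\to\mathbb R_{\ge0}$ continuous. *Samples:* one observes the $N$ input pairs $(u_0^i,u_b^i)=(u_0(\cdot;\mathbf a^i),u_b(\cdot,\cdot;\mathbf a^i))$, with $\mathbf a^1,\dots,\mathbf a^N$ independent realizations of $\mathbf a$. $\mathbb P$ refers to these samples. **CDFs and distances.** $\mathcal{CD}(\mathbb R)$ is the set of CDFs of real random variables. $F^{\mathrm{true}}_{u(\mathbf x,t)}$ is the CDF of the random variable $u(\mathbf x,t)$. $\widehat F^N_{u_0(\mathbf x)}$, $\widehat F^N_{u_b(\mathbf x,t)}$ are the CDFs of $\frac1N\sum_i\delta_{u_0(\mathbf x;\mathbf a^i)}$ and $\frac1N\sum_i\delta_{u_b(\mathbf x,t;\mathbf a^i)}$. $W_1$ denotes the 1-Wasserstein distance (Euclidean norm), also written as a distance between CDFs of scalar distributions; for those $W_1(F,G)=\int_{\mathbb R}|F(s)-G(s)|ds$. **Radius.** $\rho_{\mathbf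 a}:=\mathrm{diam}(\mathrm{supp}(P^{\mathrm{true}}_{\mathbf a}))/2$, with diameter in the norm $\|\cdot\|_\infty$, and $\epsilon_N(\beta,\rho)=\big(\ln(C\beta^{-1})/c\big)^{1/2}\rho N^{-1/2}$ if $n=1$; $\epsilon_N(\beta,\rho)=h^{-1}\big(\ln(C\beta^{-1})/(cN)\big)\rho$ if $n=2$, with $h(x)=x^2/[\ln(2+1/x)]^2$, $x>0$; $\epsilon_N(\beta,\rho)=\big(\ln(C\beta^{-1})/c\big)^{1/n}\rho N^{-1/n}$ if $n\ge3$. Here $C,c>0$ depend only on $n$ and are the constants of the following known concentration result: if $X_1,\dots,X_N$ are i.i.d. in $\mathbb R^n$ with compactly supported law $\mu$, $\rho=\mathrm{diam}(\mathrm{supp}(\mu))/2$ (in $\|\cdot\|_\infty$) and $\widehat\mu^N=\frac1N\sum_i\delta_{X_i}$, then $\mathbb P(W_1(\widehat\mu^N,\mu)\le\epsilon_N(\beta,\rho))\ge1-\beta$. **Solutions.** Solutions are understood by characteristics. For the CDF equation (data $F_{u_0(\mathbf x)}(U)$ on $\mathbb R\times\Omega$ at $t=0$ and $F_{u_b(\mathbf x,t)}(U)$ on $\mathbb R\times\Gamma$, $t>0$), the solution is constant along the curves $\frac{d\mathbf x}{dt}=\dot{\mathbf q}$, $\frac{dU}{dt}=r(U;\boldsymbol\theta_r)$ and equals the prescribed datum where the curve starts from the initial or boundary surface. For the equation of $w$, along the curves $\frac{d\mathbf x}{dt}=\dot{\mathbf q}$ one has $\frac{dw}{dt}=\dot r\,w$,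 with the prescribed value at the starting point. The coefficients are regular enough that each point of the space-time domain lies on exactly one such curve, started from exactly one point of the (noncharacteristic) initial/boundary surface. It is a known result that the CDF of $u(\mathbf x,t)$ solves the CDF equation with data the CDFs of $u_0(\mathbf x)$ and $u_b(\mathbf x,t)$. *)

(* Defs.v *)
From HB Require Import structures.
From mathcomp Require Import all_boot all_order all_algebra.
From mathcomp Require Import all_classical all_reals all_analysis.
Import Order.TTheory GRing.Theory Num.Theory.
Import numFieldNormedType.Exports.

Set Implicit Arguments.
Unset Strict Implicit.
Unset Printing Implicit Defensive.

Local Open Scope classical_set_scope.
Local Open Scope ring_scope.

(* Omega is open, so that Gamma, a part of its boundary, is disjoint from it.
   The parameters take values in arbitrary types. *)
Record model (R : realType) (d : nat) := Model {
  Omega : set 'rV[R]_d ;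
  Gamma : set 'rV[R]_d ;
  param_q : Type ;
  param_r : Type ;
  theta_q : 'rV[R]_d -> R -> param_q ;
  theta_r : 'rV[R]_d -> R -> param_r ;
  q_fun : R -> param_q -> 'rV[R]_d ;
  r_fun : R -> param_r -> R
}.

Section model_defs.
Context {R : realType} {d : nat}.
Variable M : model R d.
Implicit Types (U t : R) (x : 'rV[R]_d) (X : R -> 'rV[R]_d) (V : R -> R).

Definition flux U x t : 'rV[R]_d := q_fun U (theta_q M x t).
Definition source U x t : R := r_fun U (theta_r M x t).

Definition flux_dot U x t : 'rV[R]_d := derive1 (fun V : R => flux V x t) U.
Definition source_dot U x t : R := derive1 (fun V : R => source V x t : R^o) U.

Definition divergence (G : 'rV[R]_d -> 'rV[R]_d) x : R :=
  \sum_(i < d) 'D_(delta_mx 0 i) (fun y => G y 0 i : R^o) x.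

Definition semi_infinite : Prop :=
  [/\ open (Omega M), ~ bounded_set (Omega M)
    & Gamma M `<=` closure (Omega M) `\` Omega M].

(* Linearity of the equation: as functions of U, q and r have degree at most one,
   with coefficients depending on (x, t). The terms e and m constant in U are
   those of a linear equation with a source; e = 0 and m = 0 is the
   homogeneous case. *)
Definition linear_pde : Prop :=
  forall x t, Omega M x -> 0 < t ->
    exists (b e : 'rV[R]_d) (k m : R), forall U,
      flux U x t = U *: b + e /\ source U x t = k * U + m.

Definition divergence_free_flux : Prop :=
  forall U x t, Omega M x -> 0 < t ->
    differentiable (fun y => flux U y t) x /\
    divergence (fun y => flux U y t) x = 0.

(* A smooth solution up to the initial and boundary surfaces; of smoothness
   only differentiability inside and continuity up to the boundary are
   recorded. *)
Definition solves_pde (u : 'rV[R]_d -> R -> R)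
    (u0 : 'rV[R]_d -> R) (ub : 'rV[R]_d -> R -> R) : Prop :=
  [/\ {within (Omega M `|` Gamma M) `*` [set t : R | 0 <= t],
        continuous (fun p : 'rV[R]_d * R => u p.1 p.2)},
      forall x t, Omega M x -> 0 < t ->
        differentiable (fun p : 'rV[R]_d * R^o => u p.1 p.2 : R^o) (x, t),
      forall x t, Omega M x -> 0 < t ->
        derive1 (u x : R -> R^o) t + divergence (fun y => flux (u y t) y t) x
          = source (u x t) x t,
      forall x, Omega M x -> u x 0 = u0 x
    & forall x t, Gamma M x -> 0 <= t -> u x t = ub x t].

(* The initial/boundary surface. It contains Gamma at time 0, so that the
   characteristic issued from the corner has a starting point. *)
Definition on_surface x t : Prop :=
  (Omega M x /\ t = 0) \/ (Gamma M x /\ 0 <= t).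

(* The datum prescribed at a point of the surface: points over Omega belong to
   the initial surface. *)
Definition surface_datum (A : Type) (f0 : 'rV[R]_d -> A)
    (fb : 'rV[R]_d -> R -> A) x t : A :=
  if `[< Omega M x >] then f0 x else fb x t.

(* X is a curve on [t0, t] with velocity v, issued from the surface at t0 and
   lying in Omega afterwards; values of X outside [t0, t] are irrelevant. *)
Definition ground_curve (v : R -> 'rV[R]_d) (t0 t : R) X : Prop :=
  [/\ t0 <= t, on_surface (X t0) t0, {within `[t0, t], continuous X},
      forall s, t0 < s <= t -> Omega M (X s)
    & forall s, t0 < s < t -> is_derive s 1 X (v s)].

Definition cdf_characteristic (t0 t : R) X V : Prop :=
  [/\ ground_curve (fun s => flux_dot (V s) (X s) s) t0 t X,
      {within `[t0, t], continuous V}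
    & forall s, t0 < s < t -> is_derive s 1 V (source (V s) (X s) s)].

(* Only used under linear_pde, where the derivatives in U do not
   depend on U; here and in solves_w they are evaluated at U = 0. *)
Definition w_characteristic (t0 t : R) X : Prop :=
  ground_curve (fun s => flux_dot 0 (X s) s) t0 t X.

(* Each space-time point lies on exactly one characteristic, issued from
   exactly one point of the surface: one ends there, and two that share a
   point have the same start and coincide as long as both are defined. *)
Definition unique_w_characteristics : Prop :=
  (forall x t, Omega M x -> 0 <= t ->
    exists t0 X, w_characteristic t0 t X /\ X t = x) /\
  (forall t0 t X t0' t' X' s,
    w_characteristic t0 t X -> w_characteristic t0' t' X' ->
    t0 <= s <= t -> t0' <= s <= t' -> X s = X' s ->
    t0 = t0' /\ forall tau, t0 <= tau <= Num.min t t' -> X tau = X' tau).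

Definition unique_cdf_characteristics : Prop :=
  (forall U x t, Omega M x -> 0 <= t ->
    exists t0 X V, [/\ cdf_characteristic t0 t X V, X t = x & V t = U]) /\
  (forall t0 t X V t0' t' X' V' s,
    cdf_characteristic t0 t X V -> cdf_characteristic t0' t' X' V' ->
    t0 <= s <= t -> t0' <= s <= t' -> X s = X' s -> V s = V' s ->
    t0 = t0' /\
    forall tau, t0 <= tau <= Num.min t t' -> X tau = X' tau /\ V tau = V' tau).

(* F x t U is the value at U of the CDF attached to (x, t). *)
Definition solves_cdf_equation (F : 'rV[R]_d -> R -> R -> R)
    (F0 : 'rV[R]_d -> R -> R) (Fb : 'rV[R]_d -> R -> R -> R) : Prop :=
  forall t0 t X V, cdf_characteristic t0 t X V ->
    forall s, t0 <= s <= t ->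
      F (X s) s (V s) = surface_datum F0 Fb (X t0) t0 (V t0).

Definition solves_w (w : 'rV[R]_d -> R -> R)
    (w0 : 'rV[R]_d -> R) (wb : 'rV[R]_d -> R -> R) : Prop :=
  forall t0 t X, w_characteristic t0 t X ->
    [/\ {within `[t0, t], continuous (fun s => w (X s) s)},
        w (X t0) t0 = surface_datum w0 wb (X t0) t0
      & forall s, t0 < s < t ->
          is_derive s 1 (fun s => w (X s) s)
            (source_dot 0 (X s) s * w (X s) s)].

End model_defs.

(* R^n with its Borel sigma-algebra. *)
Notation Rn R n := (g_sigma_algebraType (@open 'rV[R]_n)).

Definition enorm (R : realType) (n : nat) (v : 'rV[R]_n) : R :=
  Num.sqrt (\sum_(i < n) v 0 i ^+ 2).

(* "P(E) >= p" for an event E that is not known beforehand to be measurable;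
   see prob_at_least_measurable. *)
Definition prob_at_least d (T : measurableType d) (R : realType)
    (P : probability T R) (E : set T) (p : R) : Prop :=
  exists B, [/\ measurable B, B `<=` E & (p%:E <= P B)%E].

Lemma prob_at_least_measurable d (T : measurableType d) (R : realType)
    (P : probability T R) (E : set T) (p : R) :
  measurable E -> prob_at_least P E p <-> (p%:E <= P E)%E.
Proof.
move=> mE; split=> [[B [mB BE pB]]|pE]; last by exists E; split.
by apply: (le_trans pB); apply: le_measure; rewrite ?inE.
Qed.

Section probability_defs.
Context {R : realType}.

Definition iid d d' (T : measurableType d) (E : measurableType d')
    (P : probability T R) (mu : set E -> \bar R) (N : nat)
    (X : 'I_N -> {RV P >-> E}) : Prop :=
  (forall i B, measurable B -> distribution P (X i) B = mu B) /\
  (forall B : 'I_N -> set E, (forall i, measurable (B i)) ->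
    P (\bigcap_i (X i @^-1` B i)) = (\prod_(i < N) P (X i @^-1` B i))%E).

Definition empirical d (E : measurableType d) (N : nat) (X : 'I_N -> E)
    (B : set E) : \bar R :=
  ((N%:R^-1)%:E * \sum_(i < N) \d_(X i) B)%E.

Definition cdf_of (mu : set (measurableTypeR R) -> \bar R) : R -> R :=
  fun s => fine (mu `]-oo, s]%classic).

Definition CD : set (R -> R) :=
  [set F | exists nu : probability (measurableTypeR R) R, F = cdf_of nu].

Definition W1_cdf (F G : R -> R) : \bar R :=
  (\int[lebesgue_measure]_s (`|F s - G s|)%:E)%E.

Definition ambiguity_set (F : R -> R) (rad : R) : set (R -> R) :=
  [set G | CD G /\ (W1_cdf F G <= rad%:E)%E].

Section euclidean.
Context {n : nat}.
Implicit Types mu nu : set (Rn R n) -> \bar R.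

Definition compactly_supported mu : Prop :=
  exists2 K : set 'rV[R]_n, compact K & mu (~` K) = 0%E.

Definition support mu : set 'rV[R]_n :=
  [set x | forall V : set 'rV[R]_n, open V -> V x -> (0 < mu V)%E].

(* `|x| on 'rV[R]_n is the maximum norm. *)
Definition half_diam_support mu : R :=
  sup [set z | exists x y, [/\ support mu x, support mu y & z = `|x - y|]] / 2.

Definition coupling mu nu (pi : probability (Rn R n * Rn R n)%type R) : Prop :=
  forall B, measurable B ->
    pi (B `*` setT) = mu B /\ pi (setT `*` B) = nu B.

Definition W1 mu nu : \bar R :=
  ereal_inf [set (\int[pi]_z (enorm (z.1 - z.2 : 'rV[R]_n))%:E)%E
            | pi in coupling mu nu].

End euclidean.

(* Rate function of dimension 2 and its inverse on the positive half-line. *)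
Definition h2 (x : R) : R := x ^+ 2 / (ln (2 + x^-1)) ^+ 2.

Definition h2_inv (y : R) : R := xget 0 [set x | 0 < x /\ h2 x = y].

Definition epsilon (n : nat) (C c : R) (N : nat) (beta rho : R) : R :=
  if n == 1%N then
    (ln (C * beta^-1) / c) `^ (2^-1) * rho * N%:R `^ (- 2^-1)
  else if n == 2%N then
    h2_inv (ln (C * beta^-1) / (c * N%:R)) * rho
  else
    (ln (C * beta^-1) / c) `^ (n%:R^-1) * rho * N%:R `^ (- n%:R^-1).

(* C and c are admissible constants in the concentration inequality for the
   empirical measure in dimension n. *)
Definition concentration_constants (n : nat) (C c : R) : Prop :=
  [/\ 0 < C, 0 < c &
    forall (d : measure_display) (T : measurableType d) (P : probability T R)
      (mu : probability (Rn R n) R) (N : nat) (X : 'I_N -> {RV P >-> Rn R n})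
      (beta : R),
    (0 < N)%N -> compactly_supported mu -> iid mu X -> 0 < beta < 1 ->
    prob_at_least P
      [set o | (W1 (empirical (fun i => X i o)) mu
                <= (epsilon n C c N beta (half_diam_support mu))%:E)%E]
      (1 - beta)].

Definition lipschitz_inputs (d n : nat) (M : model R d)
    (u0 : 'rV[R]_d -> Rn R n -> R) (ub : 'rV[R]_d -> R -> Rn R n -> R)
    (L0 : 'rV[R]_d -> R) (Lb : 'rV[R]_d -> R -> R) : Prop :=
  [/\ {within Omega M, continuous L0} /\ (forall x, Omega M x -> 0 <= L0 x),
      {within Gamma M `*` [set t : R | 0 <= t],
        continuous (fun p : 'rV[R]_d * R => Lb p.1 p.2)} /\
      (forall x t, Gamma M x -> 0 <= t -> 0 <= Lb x t),
      forall x, Omega M x -> forall a a' : 'rV[R]_n,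
        `|u0 x a - u0 x a'| <= L0 x * enorm (a - a')
    & forall x t, Gamma M x -> 0 <= t -> forall a a' : 'rV[R]_n,
        `|ub x t a - ub x t a'| <= Lb x t * enorm (a - a')].

End probability_defs.

(* Main.v *)
Require Import Defs.
From HB Require Import structures.
From mathcomp Require Import all_boot all_order all_algebra.
From mathcomp Require Import all_classical all_reals all_analysis.
From mathcomp Require Import measurable_realfun ring.
Import Order.TTheory GRing.Theory Num.Theory.
Import numFieldNormedType.Exports.

Set Implicit Arguments.
Unset Strict Implicit.
Unset Printing Implicit Defensive.

Local Open Scope classical_set_scope.
Local Open Scope ring_scope.

(** The point of linearity is that the solution at a space-time point is an
    affine function, the same for all inputs, of the datum prescribed at one
    point of the initial or boundary surface. Let (x, t) be a point of the
    domain and X the ground characteristic that reaches it, issued from the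
    surface at time t0. The velocity does not depend on U,
    so the characteristics of the CDF equation that end over (x, t) all lie
    over this same X, and their U-components solve one scalar affine equation
    V' = k V + m. Hence their starting values are V(t0) = alpha + gamma V(t)
    with alpha and gamma common to all of them, and gamma > 0
    ([characteristic_foot]). The same gamma governs the homogeneous equation
    h' = k h, of which w is a solution along X.

    Write D(a) for the datum prescribed at the foot of X when the input
    parameter is a, L for its Lipschitz constant there, and
    psi(a) = (D(a) - alpha) / gamma. Three facts result.
    - The solution u(X(s), s) is itself a characteristic of the CDF equation
      ([solution_along_characteristic]), so u(x, t) = psi(a) and the true CDF
      at (x, t) is that of the image of the law of a under psi.
    - The CDF equation transports the empirical CDF of the data D(a^i) to the
      empirical CDF of the points psi(a^i).
    - w(x, t) = L eps / gamma, and L / gamma is a Lipschitz constant of psi.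

    A map with Lipschitz constant K increases the 1-Wasserstein distance at
    most K times ([W1_cdf_lipschitz_image]). So as soon as the empirical law of
    a^1, ..., a^N is within eps of the law of a, the true CDF belongs to the
    ambiguity set at all points (x, t) at once; the concentration inequality
    bounds from below the probability of this one event. *)

(** * Wasserstein distance of scalar images *)

Lemma measurable_cdf_of (R : realType) (mu : probability (measurableTypeR R) R) :
  measurable_fun setT (cdf_of mu).
Proof.
apply: nondecreasing_measurable => // s t st.
rewrite /cdf_of fine_le ?fin_num_measure//.
apply: le_measure; rewrite ?inE//.
by apply: subset_itvl; rewrite bnd_simp.
Qed.

(** This is the easy half of W1(F, G) = integral of |F - G|. The value
    |f1 z - f2 z| is the length of the interval between f1 z and f2 z. By
    Tonelli its expectation is the integral over s of the probability that s
    lies between f1 and f2, and this probability bounds the difference of the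
    two CDFs at s. *)
Lemma cdf_distance_le_expectation d (Z : measurableType d) (R : realType)
    (pi : probability Z R) (f1 f2 : {RV pi >-> measurableTypeR R}) :
  (W1_cdf (cdf_of (distribution pi f1)) (cdf_of (distribution pi f2))
   <= \int[pi]_z (`|f1 z - f2 z|)%:E)%E.
Proof.
have mf1 : measurable_fun setT f1 by exact: measurable_funPT.
have mf2 : measurable_fun setT f2 by exact: measurable_funPT.
pose lo z := Num.min (f1 z) (f2 z); pose hi z := Num.max (f1 z) (f2 z).
(* S is the region lo z <= s < hi z: half-open, because f z <= s is closed. *)
pose S : set (Z * measurableTypeR R) :=
  [set p | lo p.1 <= p.2] `&` ~` [set p | hi p.1 <= p.2].
have mlo : measurable_fun setT (fun p : Z * measurableTypeR R => lo p.1).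
  apply: (measurableT_comp (_ : measurable_fun setT lo) measurable_fst).
  exact: (@measurable_minr _ _ _ setT f1 f2 mf1 mf2).
have mhi : measurable_fun setT (fun p : Z * measurableTypeR R => hi p.1).
  apply: (measurableT_comp (_ : measurable_fun setT hi) measurable_fst).
  exact: (@measurable_maxr _ _ _ setT f1 f2 mf1 mf2).
have mS : measurable S.
  apply: measurableI; last apply: measurableC.
    by rewrite -[X in measurable X]setTI; apply: measurable_fun_le.
  by rewrite -[X in measurable X]setTI; apply: measurable_fun_le.
have mIS : measurable_fun setT (EFin \o (\1_S : Z * measurableTypeR R -> R)).
  by apply/measurable_EFinP; exact: measurable_indic.
have preE (f : {RV pi >-> measurableTypeR R}) s :
    f @^-1` `]-oo, s]%classic = [set z | f z <= s].
  by apply/seteqP; split=> z /=; rewrite in_itv.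
have pt (f : {RV pi >-> measurableTypeR R}) s : measurable [set z | f z <= s].
  by rewrite -preE -[X in measurable X]setTI; exact: measurable_funP.
have cdfE (f : {RV pi >-> measurableTypeR R}) s :
    (cdf_of (distribution pi f) s)%:E = pi [set z | f z <= s].
  rewrite /cdf_of fineK; last exact: fin_num_measure.
  exact: (congr1 (fun A => pi A) (preE f s)).
have slice_z s : (\int[pi]_z (\1_S (z, s))%:E)%E = pi (ysection S s).
  rewrite -[ysection S s]setIT -integral_indic//; last exact: measurable_ysection.
  by apply: eq_integral => z _; rewrite !indicE mem_ysection.
have mSs s : measurable (ysection S s) by exact: measurable_ysection.
have cdf_le (g1 g2 : {RV pi >-> measurableTypeR R}) s :
    [set z | g1 z <= s] `<=` [set z | g2 z <= s] `|` ysection S s ->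
    cdf_of (distribution pi g1) s
      <= cdf_of (distribution pi g2) s + fine (pi (ysection S s)).
  move=> sub; rewrite -lee_fin EFinD !cdfE fineK ?fin_num_measure//.
  apply: (@le_trans _ _ (pi ([set z | g2 z <= s] `|` ysection S s))).
    by apply: le_measure; rewrite ?inE//; exact: measurableU.
  exact: measureU2.
have le_slice s : (`|cdf_of (distribution pi f1) s
    - cdf_of (distribution pi f2) s|%:E <= \int[pi]_z (\1_S (z, s))%:E)%E.
  rewrite slice_z -(@fineK _ (pi (ysection S s))) ?fin_num_measure// lee_fin.
  have in_slice z : lo z <= s -> s < hi z -> ysection S s z.
    move=> los shi; rewrite /ysection/= inE; split=> //=.
    by apply/negP; rewrite -ltNge.
  rewrite ler_norml lerBlDl [X in _ && X]cdf_le; last first.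
    move=> z /= f1s; have [f2s|f2s] := leP (f2 z) s; [by left|right].
    by apply: in_slice; rewrite /lo /hi ?ge_min ?lt_max ?f1s ?f2s ?orbT.
  rewrite lerNl opprB lerBlDl cdf_le//.
  move=> z /= f2s; have [f1s|f1s] := leP (f1 z) s; [by left|right].
  by apply: in_slice; rewrite /lo /hi ?ge_min ?lt_max ?f1s ?f2s ?orbT.
have slice z : (\int[lebesgue_measure]_s (\1_S (z, s))%:E = `|f1 z - f2 z|%:E)%E.
  transitivity (lebesgue_measure (`[lo z, hi z[%classic : set R)).
    rewrite -[X in lebesgue_measure X]setIT -integral_indic//.
    apply: eq_integral => s _; rewrite !indicE; congr ((nat_of_bool _)%:R%:E).
    apply/idP/idP; rewrite !inE/= in_itv/=; first by move=> [-> /negP]; rewrite -ltNge.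
    by move=> /andP[? ?]; split=> //; apply/negP; rewrite -ltNge.
  rewrite lebesgue_measure_itv/= lte_fin /lo /hi.
  have [f12|f21] := leP (f1 z) (f2 z).
    rewrite ler0_norm ?subr_le0// opprB; by case: ltgtP f12 => //= -> _; rewrite subrr.
  by rewrite f21 gtr0_norm ?subr_gt0// -EFinB.
rewrite [leRHS](_ : _ =
    \int[lebesgue_measure]_s \int[pi]_z (\1_S (z, s))%:E)%E; last first.
  rewrite -(@fubini_tonelli _ _ _ _ _ pi lebesgue_measure (EFin \o \1_S)) //.
    by apply: eq_integral => z _; rewrite slice.
  by move=> p; rewrite lee_fin indicE.
apply: ge0_le_integral => //.
- apply/measurable_EFinP; apply: measurableT_comp => //.
  by apply: measurable_funB; exact: (measurable_cdf_of (distribution pi _)).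
apply: (eq_measurable_fun (pi \o ysection S)); last exact: measurable_fun_ysection.
by move=> s _; rewrite slice_z.
Qed.

Section euclidean_inputs.
Context {R : realType} {n : nat}.

Lemma continuous_enorm : continuous (@enorm R n).
Proof.
move=> v; apply: (@continuous_comp _ _ _ _ (@Num.sqrt R)); last exact: sqrt_continuous.
apply: (@cvg_big _ _ +%R 0 xpredT (@add_continuous R) _ (nbhs v)) => i _.
rewrite /= expr2; under eq_cvg do rewrite expr2.
by apply: cvgM; exact: coord_continuous.
Qed.

Lemma enorm0 : enorm (0 : 'rV[R]_n) = 0.
Proof.
by rewrite /enorm big1 ?sqrtr0// => i _; rewrite mxE expr0n.
Qed.

Lemma continuous_measurable_Rn (g : 'rV[R]_n -> R) :
  continuous g -> measurable_fun setT (g : Rn R n -> measurableTypeR R).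
Proof.
move=> /continuousP cg mD.
apply: (measurability _ (RGenOpens.measurableE R)) => //.
move=> _ [_ [a [b ->] <-]]; rewrite setTI.
apply: sub_sigma_algebra; apply: cg; exact: interval_open.
Qed.

Lemma lipschitz_continuous (g : 'rV[R]_n -> R) K :
  (forall a a', `|g a - g a'| <= K * enorm (a - a')) -> continuous g.
Proof.
move=> lip v; apply/(@cvgrPdist_le R R^o _ (nbhs v) (nbhs_filter v)) => e e0.
have : K * enorm (v - a) @[a --> v] --> (0 : R).
  rewrite -(mulr0 K) -enorm0 -(subrr v).
  have cB : {for v, continuous (fun a : 'rV[R]_n => v - a)}.
    by apply: continuousB; [exact: cst_continuous|exact: cvg_id].
  have ce := continuous_comp cB (@continuous_enorm (v - v)).
  exact: (continuousM (@cst_continuous _ _ K v) ce).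
move/(@cvgrPdist_le R R^o _ (nbhs v) (nbhs_filter v)) => /(_ e e0).
apply: (@filterS _ (nbhs v) (nbhs_filter v)) => a /=.
rewrite sub0r normrN => h; apply: le_trans (lip _ _) _; exact: le_trans (ler_norm _) h.
Qed.

(** Continuity alone would not do: the sigma-algebra here is a product of Borel
    sigma-algebras, so the distance is built from coordinates. *)
Lemma measurable_enormB :
  measurable_fun setT
    (fun z : Rn R n * Rn R n => enorm (z.1 - z.2 : 'rV[R]_n)).
Proof.
have mcoord i : measurable_fun setT
    (fun v : Rn R n => (v : 'rV[R]_n) 0 i : measurableTypeR R).
  by apply: continuous_measurable_Rn; exact: coord_continuous.
apply: (@measurableT_comp _ _ _ _ _ _ (@Num.sqrt R)).
  by apply: continuous_measurable_fun; exact: sqrt_continuous.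
apply: measurable_sum => i; apply: measurable_funX.
apply: (eq_measurable_fun (fun z : Rn R n * Rn R n =>
    (z.1 : 'rV[R]_n) 0 i - (z.2 : 'rV[R]_n) 0 i)).
  by move=> z _; rewrite !mxE.
apply: measurable_funB.
  exact: (measurableT_comp (mcoord i) measurable_fst).
exact: (measurableT_comp (mcoord i) measurable_snd).
Qed.

Lemma cdf_of_empirical N (Y : 'I_N -> R) s :
  cdf_of (empirical (Y : 'I_N -> measurableTypeR R)) s
    = N%:R^-1 * \sum_(i < N) (Y i <= s)%R%:R.
Proof.
rewrite /cdf_of /empirical.
under eq_bigr do rewrite /dirac indicE mem_setE in_itv/=.
by rewrite sumEFin.
Qed.

(** The image under (g, g) of a coupling of the empirical measure and mu couples
    the two scalar laws, and its cost is at most K times the original one.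
    Couplings of almost minimal cost give the bound. *)
Lemma W1_cdf_lipschitz_image N (X : 'I_N -> Rn R n) (mu : probability (Rn R n) R)
    (g : Rn R n -> measurableTypeR R) (K eps : R) :
  0 <= K ->
  (forall a a' : 'rV[R]_n, `|g a - g a'| <= K * enorm (a - a')) ->
  (W1 (empirical X) mu <= eps%:E)%E ->
  (W1_cdf (cdf_of (empirical (fun i => g (X i)))) (cdf_of (pushforward mu g))
     <= (K * eps)%:E)%E.
Proof.
move=> K0 lip Weps.
have mg : measurable_fun setT g.
  by apply: continuous_measurable_Rn; exact: lipschitz_continuous lip.
have mg1 : measurable_fun setT (fun z : Rn R n * Rn R n => g z.1).
  exact: measurableT_comp.
have mg2 : measurable_fun setT (fun z : Rn R n * Rn R n => g z.2).
  exact: measurableT_comp.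
have le_coupling pi : coupling (empirical X) mu pi ->
    (W1_cdf (cdf_of (empirical (fun i => g (X i)))) (cdf_of (pushforward mu g))
     <= K%:E * \int[pi]_z (enorm (z.1 - z.2 : 'rV[R]_n))%:E)%E.
  move=> cpl.
  have := cdf_distance_le_expectation
    (mfun_Sub (mem_set mg1) : {RV pi >-> measurableTypeR R})
    (mfun_Sub (mem_set mg2) : {RV pi >-> measurableTypeR R}).
  rewrite /=.
  have -> : cdf_of (distribution pi (mfun_Sub (mem_set mg1)))
      = cdf_of (empirical (fun i => g (X i))).
    apply/funext => s; rewrite /cdf_of /distribution /pushforward/=; congr fine.
    have mB : measurable (g @^-1` `]-oo, s]%classic).
      by rewrite -[X in measurable X]setTI; exact: mg.
    transitivity (pi ((g @^-1` `]-oo, s]%classic) `*` setT)).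
      by congr (pi _); apply/seteqP; split => z //= [].
    by have [-> _] := cpl _ mB.
  have -> : cdf_of (distribution pi (mfun_Sub (mem_set mg2)))
      = cdf_of (pushforward mu g).
    apply/funext => s; rewrite /cdf_of /distribution /pushforward/=; congr fine.
    have mB : measurable (g @^-1` `]-oo, s]%classic).
      by rewrite -[X in measurable X]setTI; exact: mg.
    transitivity (pi (setT `*` (g @^-1` `]-oo, s]%classic))).
      by congr (pi _); apply/seteqP; split => z //= [].
    by have [_ ->] := cpl _ mB.
  move=> h; apply: (le_trans h).
  have menorm : measurable_fun setT
      (fun z : Rn R n * Rn R n => (enorm (z.1 - z.2 : 'rV[R]_n))%:E).
    by apply/measurable_EFinP; exact: measurable_enormB.
  rewrite -ge0_integralZl//; last by move=> z _; rewrite lee_fin sqrtr_ge0.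
  apply: ge0_le_integral => //=.
  - by apply/measurable_EFinP; apply: measurableT_comp => //; exact: measurable_funB.
  - exact: measurable_funeM.
  - by move=> z _; rewrite -EFinM lee_fin.
apply/lee_addgt0Pr => e e0.
(* K + 1 rather than K, which may vanish. *)
have : (W1 (empirical X) mu < (eps + e / (K + 1))%:E)%E.
  by apply: le_lt_trans Weps _; rewrite lte_fin ltrDl divr_gt0// ltr_wpDl.
move=> /ereal_inf_ltP[_ [pi cpl <-] cost].
apply: (le_trans (le_coupling pi cpl)).
apply: (@le_trans _ _ (K%:E * (eps + e / (K + 1))%:E)%E).
  by apply: lee_wpmul2l; [rewrite lee_fin|exact: ltW].
rewrite -EFinM -EFinD lee_fin mulrDr lerD2l mulrCA ger_pMr//.
by rewrite ler_pdivrMr ?mul1r ?lerDl// ltr_wpDl.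
Qed.
End euclidean_inputs.

(** * Characteristics of a linear equation *)

Lemma is_derive_affine (R : realType) (W : normedModType R) (b e : W) (u : R) :
  is_derive u 1 (fun z : R => z *: b + e) b.
Proof.
have lim_b : h^-1 *: (((fun z : R => z *: b + e) \o shift u) (h *: 1) - (u *: b + e))
    @[h --> 0^'] --> b.
  apply: cvg_near_cst; near=> h.
  have h0 : h != 0 by near: h; exact: nbhs_dnbhs_neq.
  rewrite /= opprD addrACA subrr addr0 -scalerBl addrK scalerA.
  by rewrite [h *: 1]mulr1 mulVf// scale1r.
apply: DeriveDef; first exact: cvgP lim_b.
exact: cvg_lim lim_b.
Unshelve. all: by end_near. Qed.

Section linear_characteristics.
Context {R : realType} {d : nat}.
Variable M : model R d.
Hypothesis linM : linear_pde M.
Implicit Types (U s t : R) (x : 'rV[R]_d) (X : R -> 'rV[R]_d) (V h : R -> R).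

Lemma flux_dotE U x t : Omega M x -> 0 < t ->
  flux_dot M U x t = flux M 1 x t - flux M 0 x t.
Proof.
move=> Ox t0; have [b [e [k [m fs]]]] := linM Ox t0.
have -> : flux M 1 x t - flux M 0 x t = b.
  by rewrite (fs 1).1 (fs 0).1 scale1r scale0r add0r addrK.
rewrite /flux_dot (_ : (fun z : R => flux M z x t) =
    fun V : R => V *: b + e); last first.
  by apply/funext => V; rewrite (fs V).1.
rewrite derive1E.
exact: (@derive_val _ _ _ _ _ _ _ (is_derive_affine b e U)).
Qed.

Lemma source_dotE U x t : Omega M x -> 0 < t ->
  source M U x t = U * source_dot M 0 x t + source M 0 x t.
Proof.
move=> Ox t0; have [b [e [k [m fs]]]] := linM Ox t0.
suff -> : source_dot M 0 x t = k by rewrite (fs U).2 (fs 0).2 mulr0 add0r mulrC.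
rewrite /source_dot (_ : (fun z : R => source M z x t : R^o) =
    fun z : R => z *: (k : R^o) + (m : R^o)); last first.
  by apply/funext => V; rewrite (fs V).2 mulrC.
rewrite derive1E.
exact: (@derive_val _ _ _ _ _ _ _ (is_derive_affine (k : R^o) m 0)).
Qed.

Lemma flux_affine U x t : Omega M x -> 0 < t ->
  flux M U x t = U *: flux_dot M 0 x t + flux M 0 x t.
Proof.
move=> Ox t0; rewrite flux_dotE//; have [b [e [k [m fs]]]] := linM Ox t0.
by rewrite (fs U).1 (fs 1).1 (fs 0).1 scale0r add0r scale1r addrK.
Qed.

Lemma ground_curve_ext (v v' : R -> 'rV[R]_d) t0 t X :
  (forall s, t0 < s < t -> v s = v' s) ->
  ground_curve M v t0 t X -> ground_curve M v' t0 t X.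
Proof. by move=> vv' [? ? ? ? dX]; split=> // s st; rewrite -vv'//; exact: dX. Qed.

Lemma ground_curve_start_ge0 (v : R -> 'rV[R]_d) t0 t X :
  ground_curve M v t0 t X -> 0 <= t0.
Proof. by case=> _ [[_ ->]|[]]. Qed.

Lemma ground_curve_inside (v : R -> 'rV[R]_d) t0 t X s :
  ground_curve M v t0 t X -> t0 < s < t -> Omega M (X s) /\ 0 < s.
Proof.
move=> gX /andP[t0s st]; split; last exact: le_lt_trans (ground_curve_start_ge0 gX) t0s.
by case: gX => _ _ _ + _; apply; rewrite t0s ltW.
Qed.

Lemma cdf_characteristic_ground t0 t X V :
  cdf_characteristic M t0 t X V -> w_characteristic M t0 t X.
Proof.
case=> gX _ _; apply: ground_curve_ext (gX) => s st.
by have [Ox s0] := ground_curve_inside gX st; rewrite !flux_dotE.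
Qed.

Lemma cdf_characteristic_of_ground t0 t X V : w_characteristic M t0 t X ->
  {within `[t0, t], continuous V} ->
  (forall s, t0 < s < t -> is_derive s 1 V (source M (V s) (X s) s)) ->
  cdf_characteristic M t0 t X V.
Proof.
move=> wX cV dV; split=> //; apply: ground_curve_ext (wX) => s st.
by have [Ox s0] := ground_curve_inside wX st; rewrite !flux_dotE.
Qed.

(** The equation of [solves_w] along X; by linearity it is also the equation of
    the differences of two CDF characteristics over X. *)
Definition homogeneous_along t0 t X h : Prop :=
  {within `[t0, t], continuous h} /\
  forall s, t0 < s < t -> is_derive s 1 h (source_dot M 0 (X s) s * h s).

Lemma cdf_characteristicB t0 t X V V' :
  cdf_characteristic M t0 t X V -> cdf_characteristic M t0 t X V' ->
  homogeneous_along t0 t X (V' - V).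
Proof.
move=> [gX cV dV] [_ cV' dV']; split; first exact: within_continuousB.
move=> s st; have [Ox s0] := ground_curve_inside gX st.
apply: is_derive_eq; first exact: is_deriveB (dV' s st) (dV s st).
rewrite (source_dotE (V s))// (source_dotE (V' s))//.
by rewrite opprD addrACA subrr addr0 -mulrBl mulrC.
Qed.

Lemma cdf_characteristicD t0 t X V h :
  cdf_characteristic M t0 t X V -> homogeneous_along t0 t X h ->
  cdf_characteristic M t0 t X (V + h).
Proof.
move=> cdfV [ch dh]; have gX := cdf_characteristic_ground cdfV.
case: cdfV => _ cV dV.
apply: cdf_characteristic_of_ground => //; first exact: within_continuousD.
move=> s st; have [Ox s0] := ground_curve_inside gX st.
apply: is_derive_eq; first exact: is_deriveD (dV s st) (dh s st).
rewrite (source_dotE (V s))// (source_dotE ((V + h) s))//.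
by rewrite addrAC mulrDl [_ * h s]mulrC.
Qed.

Lemma homogeneousZ t0 t X h (c : R) : homogeneous_along t0 t X h ->
  homogeneous_along t0 t X (c \*: h).
Proof.
move=> [ch dh]; split.
  apply: (@within_continuous_comp _ _ _ _ h ( *:%R c)) => //.
  by move=> z _; exact: scaler_continuous.
move=> s st.
apply: is_derive_eq; first exact: is_deriveZ (dh s st).
by rewrite mulrCA.
Qed.

Hypothesis wM : unique_w_characteristics M.
Hypothesis cdfM : unique_cdf_characteristics M.

Lemma cdf_characteristic_inj t0 t X V V' s :
  cdf_characteristic M t0 t X V -> cdf_characteristic M t0 t X V' ->
  t0 <= s <= t -> V s = V' s -> forall tau, t0 <= tau <= t -> V tau = V' tau.
Proof.
move=> cV cV' st Vs tau taut.
have [_ /(_ tau)] := cdfM.2 _ _ _ _ _ _ _ _ _ cV cV' st st erefl Vs.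
by rewrite minxx => /(_ taut) [].
Qed.

(** The characteristic that ends at (X t, U) lies over some ground curve ending
    at X t, and by uniqueness of ground curves this one is X. *)
Lemma cdf_characteristic_along t0 t X U : w_characteristic M t0 t X ->
  Omega M (X t) -> exists2 V, cdf_characteristic M t0 t X V & V t = U.
Proof.
move=> wX OX.
have t0t : t0 <= t by case: wX.
have t_ge0 : 0 <= t by exact: le_trans (ground_curve_start_ge0 wX) t0t.
have [t0' [X' [V [cV X't VtU]]]] := cdfM.1 U _ _ OX t_ge0.
exists V => //; have wX' := cdf_characteristic_ground cV.
have t0't : t0' <= t by case: wX'.
have tt : t0 <= t <= t by rewrite t0t lexx.
have tt' : t0' <= t <= t by rewrite t0't lexx.
have [t0E XX'] := wM.2 _ _ _ _ _ _ _ wX wX' tt tt' (esym X't).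
rewrite minxx -{}t0E in XX' cV *.
case: cV => _ contV dV; apply: cdf_characteristic_of_ground => // s st.
rewrite XX'; first exact: dV.
by case/andP: st => ? ?; rewrite !ltW.
Qed.

(** Let V0 and V1 be the characteristics over X with final values 0 and 1, and
    g = V1 - V0. By affinity V0 + U g is a characteristic with final value U,
    and by uniqueness the only one: alpha = V0 t0 and gamma = g t0. Since V0 and
    V1 never meet, g keeps the sign of g t = 1. The coefficients of the equation
    may fail to be integrable in s, hence uniqueness in place of the formula
    gamma = exp (- integral of k). *)
Lemma characteristic_foot t0 t X : w_characteristic M t0 t X -> Omega M (X t) ->
  exists alpha gamma : R, [/\ 0 < gamma,
    forall V, cdf_characteristic M t0 t X V -> V t0 = alpha + gamma * V t
    & forall h, homogeneous_along t0 t X h -> h t0 = gamma * h t].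
Proof.
move=> wX OX; have t0t : t0 <= t by case: wX.
have t0in : t0 <= t0 <= t by rewrite lexx.
have tin : t0 <= t <= t by rewrite lexx andbT.
have [V0 cV0 V0t] := cdf_characteristic_along 0 wX OX.
have [V1 cV1 V1t] := cdf_characteristic_along 1 wX OX.
pose g := V1 - V0; have gE s : g s = V1 s - V0 s by [].
have hg : homogeneous_along t0 t X g := cdf_characteristicB cV0 cV1.
have gt : g t = 1 by rewrite gE V0t V1t subr0.
have g_neq0 s : t0 <= s <= t -> g s != 0.
  move=> st; rewrite gE subr_eq0; apply/eqP => V10.
  have := cdf_characteristic_inj cV1 cV0 st V10 tin.
  by rewrite V0t V1t => /eqP; rewrite oner_eq0.
have g_gt0 : 0 < g t0.
  rewrite ltNge; apply/negP => g_le0.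
  have [] := @IVT _ g t0 t 0 t0t hg.1.
    by rewrite gt ge_min g_le0 le_max ler01 orbT.
  by move=> s; rewrite in_itv /= => /g_neq0/eqP.
have foot V : cdf_characteristic M t0 t X V -> V t0 = V0 t0 + g t0 * V t.
  move=> cV; rewrite [g t0 * _]mulrC.
  have cVt := cdf_characteristicD cV0 (homogeneousZ (V t) hg).
  apply: (cdf_characteristic_inj cV cVt tin _ t0in).
  by rewrite -[RHS]/(V0 t + V t * g t) V0t gt add0r mulr1.
exists (V0 t0), (g t0); split=> // h hh.
(* V0 + h is again a characteristic, and V0 t = 0. *)
have := foot _ (cdf_characteristicD cV0 hh).
rewrite -[(V0 + h) t0]/(V0 t0 + h t0) -[(V0 + h) t]/(V0 t + h t) V0t add0r.
by move=> /addrI.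
Qed.

End linear_characteristics.

(** * The solution along characteristics *)

Section partial_derivatives.
Context {R : realType} {d : nat}.
Variables (u : 'rV[R]_d -> R -> R) (x : 'rV[R]_d) (t : R).
Let uu := fun p : 'rV[R]_d * R^o => u p.1 p.2 : R^o.
Hypothesis du : differentiable uu (x, t).

Lemma is_diff_space :
  is_diff x (fun y => u y t : R^o) (fun v => 'd uu (x, t) (v, 0)).
Proof.
have dc : is_diff x (fun y : 'rV[R]_d => (y, t : R^o)) (fun v => (v, 0)).
  exact: (is_diff_pair (is_diff_id x) (is_diff_cst (t : R^o) x)).
exact: (is_diff_comp dc (differentiableP du)).
Qed.

Lemma derive1_time : derive1 (u x : R -> R^o) t = 'd uu (x, t) (0, 1).
Proof.
have dc : is_diff (t : R^o) (fun s : R^o => (x, s)) (fun v => (0, v)).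
  exact: (is_diff_pair (is_diff_cst x (t : R^o)) (is_diff_id (t : R^o))).
have [dut dutE] := is_diff_comp dc (differentiableP du).
by rewrite derive1E' // dutE.
Qed.

Lemma is_derive_along_curve (X : R -> 'rV[R]_d) v :
  X t = x -> is_derive t 1 X v ->
  is_derive t 1 (fun s => u (X s) s)
    (derive1 (u x : R -> R^o) t + 'd (fun y => u y t : R^o) x v).
Proof.
move=> Xt dX.
have dX1 : differentiable X t by apply/derivable1_diffP; exact: ex_derive.
have dc := is_diff_pair (differentiableP dX1) (is_diff_id (t : R^o)).
have du' : differentiable uu (X t, t) by rewrite Xt.
have [dcomp dcompE] := is_diff_comp dc (differentiableP du').
apply: DeriveDef; first exact: (diff_derivable dcomp).
rewrite (deriveE _ dcomp) dcompE /= -(deriveE _ dX1).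
have [_ ->] := is_diff_space.
have split_v : (v, 1) = (0, 1) + (v, 0) :> 'rV[R]_d * R^o.
  by congr (_, _); rewrite ?add0r ?addr0.
by rewrite (derive_val (is_derive := dX)) Xt derive1_time split_v linearD.
Qed.
End partial_derivatives.

Section solution_along_characteristics.
Context {R : realType} {d : nat}.
Variable M : model R d.
Hypothesis linM : linear_pde M.
Hypothesis openM : open (Omega M).
Hypothesis divM : divergence_free_flux M.

(** With F c = flux c (., t), linearity turns the flux of f into
    f (F 1 - F 0) + F 0. The fields F 0 and F 1 are divergence free, so only the
    derivatives that fall on f remain. *)
Lemma divergence_flux_comp (f : 'rV[R]_d -> R) x t : Omega M x -> 0 < t ->
  differentiable (f : _ -> R^o) x ->
  divergence (fun y => flux M (f y) y t) x
    = 'd (f : _ -> R^o) x (flux_dot M 0 x t).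
Proof.
move=> Ox t0 df.
pose F c i : 'rV[R]_d -> R^o := fun y => flux M c y t 0 i.
have dF c i : differentiable (F c i) x.
  have [dflux _] := divM c Ox t0.
  exact: (differentiable_comp dflux (differentiable_coord _ 0 i)).
have divF c : \sum_(i < d) 'D_(delta_mx 0 i) (F c i) x = 0.
  by have [_] := divM c Ox t0.
have summand i : 'D_(delta_mx 0 i) (fun y => flux M (f y) y t 0 i : R^o) x =
    f x * 'D_(delta_mx 0 i) (F 1 i) x - f x * 'D_(delta_mx 0 i) (F 0 i) x
    + 'D_(delta_mx 0 i) (F 0 i) x
    + flux_dot M 0 x t 0 i * 'D_(delta_mx 0 i) (f : _ -> R^o) x.
  have DE c : is_derive x (delta_mx 0 i) (F c i) ('D_(delta_mx 0 i) (F c i) x).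
    by apply: derivableP; exact: diff_derivable.
  have Df : is_derive x (delta_mx 0 i) (f : _ -> R^o)
      ('D_(delta_mx 0 i) (f : _ -> R^o) x).
    by apply: derivableP; exact: diff_derivable.
  rewrite (@near_eq_derive _ _ _ _
    ((f : _ -> R^o) * F 1 i - (f : _ -> R^o) * F 0 i + F 0 i)); last first.
    have : \forall y \near x, Omega M y by exact: open_nbhs_nbhs.
    apply: filterS => y Oy.
    rewrite (flux_affine linM)// (flux_dotE linM)// !mxE.
    by rewrite mulrBr.
  have := is_deriveD
    (is_deriveB (is_deriveM Df (DE 1)) (is_deriveM Df (DE 0))) (DE 0).
  move/(@derive_val _ _ _ _ _ _ _) => ->.
  rewrite (flux_dotE linM)// !mxE.
  rewrite /GRing.scale/= /F; ring.
rewrite /divergence (eq_bigr _ (fun i _ => summand i)) !big_split/= sumrN.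
rewrite -!mulr_sumr !divF.
rewrite !mulr0 subrr !add0r [flux_dot M 0 x t in RHS]row_sum_delta linear_sum.
by apply: eq_bigr => i _; rewrite linearZ deriveE.
Qed.

(** Along X the total derivative of u is the left-hand side of the equation, by
    [divergence_flux_comp], so it equals the source; the value at the foot is
    the prescribed datum. *)
Lemma solution_along_characteristic (u : 'rV[R]_d -> R -> R) u0 ub t0 t X :
  Gamma M `<=` closure (Omega M) `\` Omega M ->
  solves_pde M u u0 ub -> w_characteristic M t0 t X ->
  cdf_characteristic M t0 t X (fun s => u (X s) s) /\
  u (X t0) t0 = surface_datum M u0 ub (X t0) t0.
Proof.
move=> GO [cu du pde ui ubd] wX; split; last first.
  rewrite /surface_datum; have [_ surf _ _ _] := wX.
  case: asboolP => OX; case: surf => [[Ox t00]|[GX t0_ge0]].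
  - by rewrite t00 -ui// -t00.
  - by have [_] := GO _ GX.
  - by [].
  - exact: ubd.
apply: (cdf_characteristic_of_ground linM) => //.
  have [t0t surf cX OX _] := wX.
  have t0_ge0 := ground_curve_start_ge0 wX.
  apply/subspace_continuousP => s sI.
  have inA r : r \in `[t0, t] ->
      ((Omega M `|` Gamma M) `*` [set t : R | 0 <= t]) (X r, r).
    rewrite in_itv/= => /andP[t0r rt]; split => /=; last exact: le_trans t0r.
    move: t0r; rewrite le_eqVlt => /predU1P[<-|t0r].
      by case: surf => [[? _]|[? _]]; [left|right].
    by left; apply: OX; rewrite t0r.
  have cXs : (X r, r) @[r --> within `[t0, t] (nbhs s)] --> (X s, s).
    have c1 : X r @[r --> within `[t0, t] (nbhs s)] --> X s.
      by move/subspace_continuousP : cX; exact.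
    have c2 : r @[r --> within `[t0, t] (nbhs s)] --> s by exact: cvg_within.
    exact: (cvg_pair c1 c2).
  have /subspace_continuousP/(_ _ (inA s sI)) cus := cu.
  apply: (cvg_trans _ cus) => P /= nP.
  have := cXs _ nP.
  rewrite /= /nbhs/= /within/=; apply: filterS => r h rI; apply: h => //; exact: inA.
move=> s st; have [Ox s0] := ground_curve_inside wX st.
have [_ _ _ _ dX] := wX.
have duXs := du _ _ Ox s0.
apply: is_derive_eq; first exact: (is_derive_along_curve duXs erefl (dX s st)).
have [dux _] := is_diff_space duXs.
by rewrite -(pde _ _ Ox s0) (divergence_flux_comp Ox s0 dux).
Qed.

End solution_along_characteristics.

(** * Confidence bound for the ambiguity sets *)

Theorem theorem6p2
  (R : realType) (d n N : nat)
  (d_gt0 : (0 < d)%N) (n_gt0 : (0 < n)%N) (N_gt0 : (0 < N)%N)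
  (M : model R d)
  (domain_M : semi_infinite M)
  (linear_M : linear_pde M)
  (div_free_M : divergence_free_flux M)
  (w_char_M : unique_w_characteristics M)
  (cdf_char_M : unique_cdf_characteristics M)
  (u0 : 'rV[R]_d -> Rn R n -> R) (ub : 'rV[R]_d -> R -> Rn R n -> R)
  (L0 : 'rV[R]_d -> R) (Lb : 'rV[R]_d -> R -> R)
  (lip : lipschitz_inputs M u0 ub L0 Lb)
  (d0 : measure_display) (T0 : measurableType d0) (P0 : probability T0 R)
  (a : {RV P0 >-> Rn R n})
  (compact_a : compactly_supported (distribution P0 a))
  (u : T0 -> 'rV[R]_d -> R -> R)
  (pde_u : forall o, solves_pde M (u o)
             (fun x => u0 x (a o)) (fun x t => ub x t (a o)))
  (d1 : measure_display) (T : measurableType d1) (P : probability T R)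
  (A : 'I_N -> {RV P >-> Rn R n})
  (iid_A : iid (distribution P0 a) A)
  (C c : R) (Cc : concentration_constants n C c)
  (beta : R) (beta01 : 0 < beta < 1)
  (w : 'rV[R]_d -> R -> R)
  (eq_w : let eps := epsilon n C c N beta
                       (half_diam_support (distribution P0 a)) in
          solves_w M w (fun x => L0 x * eps) (fun x t => Lb x t * eps))
  (Fhat : T -> 'rV[R]_d -> R -> R -> R)
  (eq_Fhat : forall o, solves_cdf_equation M (Fhat o)
     (fun x => cdf_of (empirical (fun i => u0 x (A i o))))
     (fun x t => cdf_of (empirical (fun i => ub x t (A i o))))) :
  let Ftrue x t := cdf_of (pushforward P0 (fun o => u o x t)) in
  prob_at_least P
    [set o | forall x t, Omega M x -> 0 <= t ->
               ambiguity_set (Fhat o x t) (w x t) (Ftrue x t)]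
    (1 - beta).
Proof.
move=> Ftrue.
have [open_Omega _ Gamma_bd] := domain_M.
have [[_ L0_ge0] [_ Lb_ge0] lip0 lipb] := lip.
have [_ _ conc] := Cc.
have := conc _ _ P (distribution P0 a) N A beta N_gt0 compact_a iid_A beta01.
set eps := epsilon _ _ _ _ _ _ => -[B [mB BW PB]].
exists B; split=> // o /BW /= W_le x t Ox t_ge0.
have [t0 [X [wX Xt]]] := w_char_M.1 x t Ox t_ge0.
have OX : Omega M (X t) by rewrite Xt.
have t0t : t0 <= t by case: wX.
have [alpha [gamma [gamma_gt0 foot foot_hom]]] :=
  characteristic_foot linear_M w_char_M cdf_char_M wX OX.
pose D b := surface_datum M (fun y => u0 y b) (fun y s => ub y s b) (X t0) t0.
pose L := surface_datum M L0 Lb (X t0) t0.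
pose psi b : measurableTypeR R := gamma^-1 * (D b - alpha).
have [_ surf _ _ _] := wX.
have L_ge0 : 0 <= L.
  rewrite /L /surface_datum; case: asboolP => OX0; first exact: L0_ge0.
  by case: surf => [[]//|[? ?]]; exact: Lb_ge0.
have lipD (b b' : 'rV[R]_n) : `|D b - D b'| <= L * enorm (b - b').
  rewrite /D /L /surface_datum; case: asboolP => OX0; first exact: lip0.
  by case: surf => [[]//|[? ?]]; exact: lipb.
have lip_psi (b b' : 'rV[R]_n) : `|psi b - psi b'| <= gamma^-1 * L * enorm (b - b').
  rewrite /psi -mulrBr opprB addrA subrK normrM gtr0_norm ?invr_gt0//.
  by rewrite -mulrA ler_pM2l ?invr_gt0.
have wE : w x t = gamma^-1 * (L * eps).
  have [cw wt0 dw] := eq_w _ _ _ wX.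
  have := foot_hom (fun s => w (X s) s) (conj cw dw).
  rewrite /= Xt wt0 => wt.
  have <- : gamma * w x t = L * eps.
    by rewrite -wt /L /surface_datum; case: asboolP.
  by rewrite mulKf// gt_eqF.
have uE o' : u o' x t = psi (a o').
  have [cdf_u ut0] := solution_along_characteristic linear_M open_Omega
    div_free_M Gamma_bd (pde_u o') wX.
  have := foot _ cdf_u; rewrite Xt ut0 => Da.
  by rewrite /psi /D Da addrC addKr mulKf// gt_eqF.
have mpsi : measurable_fun setT (psi : Rn R n -> measurableTypeR R).
  by apply: continuous_measurable_Rn; exact: lipschitz_continuous lip_psi.
have FtrueE : Ftrue x t =
    cdf_of (pushforward (distribution P0 a) (psi : Rn R n -> measurableTypeR R)).
  rewrite /Ftrue; congr (cdf_of (pushforward _ _)).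
  by apply/funext => o'; rewrite uE.
have FhatE : Fhat o x t = cdf_of (empirical (fun i => psi (A i o))).
  apply/funext => U.
  have [V cV Vt] :=
    cdf_characteristic_along linear_M w_char_M cdf_char_M U wX OX.
  have := eq_Fhat o _ _ _ _ cV t; rewrite Xt Vt t0t lexx => /(_ isT) ->.
  rewrite (foot _ cV) Vt.
  transitivity (cdf_of (empirical (fun i => D (A i o))) (alpha + gamma * U)).
    by rewrite /D /surface_datum; case: asboolP.
  rewrite !cdf_of_empirical; congr (_ * _); apply: eq_bigr => i _.
  congr (nat_of_bool _)%:R.
  by rewrite /psi ler_pdivrMl// lerBlDl.
rewrite FtrueE FhatE wE mulrA; split.
  by exists (distribution (distribution P0 a)
    (mfun_Sub (mem_set mpsi) : {RV (distribution P0 a) >-> measurableTypeR R})).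
have K_ge0 : 0 <= gamma^-1 * L by rewrite mulr_ge0// invr_ge0 ltW.
exact: (W1_cdf_lipschitz_image K_ge0 lip_psi W_le).
Qed.
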